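(* Let $\theta>0$ and let $R_m$ denote the $m$-th upper record value from the Lomax distribution with parameter $\theta$. For $x\ge 0$ and $m\ge1$ define $$\hat\theta_{(\mathrm{Records},m)}=\frac{\ln(1+R_m)}{m},\qquad \hat f_{(\mathrm{Records},m)}(x)=\frac{m}{\ln(1+R_m)}(1+x)^{-\left(\frac{m}{\ln(1+R_m)}+1\right)},\qquad \hat F_{(\mathrm{Records},m)}(x)=1-(1+x)^{-\frac{m}{\ln(1+R_m)}}.$$ Then, as $m\to\infty$, with convergence in probability: (I) $\hat f_{(\mathrm{Records},m)}(x)\xrightarrow{P} f(x;\theta)=\frac1\theta(1+x)^{-(\frac1\theta+1)}$ for every $x\ge0$; (II) $\hat F_{(\mathrm{Records},m)}(x)\xrightarrow{P} F(x;\theta)=1-(1+x)^{-\frac1\theta}$ for every $x\ge0$; (III) $\hat\theta_{(\mathrm{Records},m)}\xrightarrow{P}\theta$.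
   Context: The Lomax distribution with parameter $\theta>0$ has probability density function $f(x;\theta)=\frac1\theta(1+x)^{-(\frac1\theta+1)}$ for $x\ge 0$ (and $0$ for $x<0$) and cumulative distribution function $F(x;\theta)=1-(1+x)^{-1/\theta}$ for $x\ge0$. Upper record values: for an infinite i.i.d. sequence $X_1,X_2,\dots$ from a continuous distribution, set $T_1=1$, $T_{k+1}=\min\{j>T_k: X_j>X_{T_k}\}$ (almost surely finite for the Lomax distribution), and $R_k=X_{T_k}$; $R_k$ is the $k$-th upper record value. The joint density of $(R_1,\dots,R_m)$ is $f(r_m;\theta)\prod_{i=1}^{m-1}\frac{f(r_i;\theta)}{1-F(r_i;\theta)}$ on $0\le r_1<\dots<r_m$. $\hat\theta_{(\mathrm{Records},m)}$ is the maximum likelihood estimator of $\theta$ based on the first $m$ upper records, and $\hat f_{(\mathrm{Records},m)}$, $\hat F_{(\mathrm{Records},m)}$ are obtained by substituting it for $\theta$ in $f$ and $F$; they are defined almost surely since $R_m>0$ almost surely. *)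

(* Defs.v *)
From HB Require Import structures.
From mathcomp Require Import all_boot all_order all_algebra finmap.
From mathcomp Require Import all_classical all_reals all_analysis.

Set Implicit Arguments.
Unset Strict Implicit.
Unset Printing Implicit Defensive.

Import Order.TTheory GRing.Theory Num.Theory.
Import numFieldNormedType.Exports.

Local Open Scope classical_set_scope.
Local Open Scope ring_scope.

Definition lomax_pdf {R : realType} (theta x : R) : R :=
  if 0 <= x then theta^-1 * (1 + x) `^ (- (theta^-1 + 1)) else 0.

Definition lomax_cdf {R : realType} (theta x : R) : R :=
  if 0 <= x then 1 - (1 + x) `^ (- theta^-1) else 0.

Definition has_lomax_law {R : realType} {d : measure_display}
    {T : measurableType d} (P : probability T R) (theta : R)
    (X : {RV P >-> R}) : Prop :=
  forall A : set R, measurable A ->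
    distribution P X A =
    (\int[lebesgue_measure]_(x in A) (lomax_pdf theta x)%:E)%E.

Definition mutually_independent {R : realType} {d : measure_display}
    {T : measurableType d} (P : probability T R) (X : nat -> {RV P >-> R}) :
    Prop :=
  forall (J : {fset nat}) (A : nat -> set R), (forall i, measurable (A i)) ->
    P (\bigcap_(i in [set` J]) (X i @^-1` A i)) =
    (\prod_(i <- J) P (X i @^-1` A i))%E.

(* Sequences are indexed from 0: the entry [x i] is the observation number
   [i.+1].  If no entry after [t] exceeds [x t], the value is the dummy [t];
   for i.i.d. observations with a continuous law this almost surely does not
   happen at a record time [t]. *)
Definition next_record {R : realType} (x : nat -> R) (t : nat) : nat :=
  if pselect (exists j : nat, (t < j)%N && (x t < x j)) is left ex
  then ex_minn ex else t.

(* Records are numbered from 1: the index of the [m]-th record is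
   [record_time x m], and [m = 0] is a dummy case. *)
Definition record_time {R : realType} (x : nat -> R) (m : nat) : nat :=
  iter m.-1 (next_record x) 0%N.

Definition upper_record {R : realType} {T : Type} (X : nat -> T -> R)
    (m : nat) (w : T) : R :=
  X (record_time (X ^~ w) m) w.

(* The estimators are functions of the [m]-th record value [r].  At [r = 0]
   the quotient [m / ln (1 + r)] is [0] by the convention [0^-1 = 0]; for the
   Lomax distribution this is a null event. *)
Definition theta_records {R : realType} (m : nat) (r : R) : R :=
  ln (1 + r) / m%:R.

Definition pdf_records {R : realType} (m : nat) (x r : R) : R :=
  m%:R / ln (1 + r) * (1 + x) `^ (- (m%:R / ln (1 + r) + 1)).

Definition cdf_records {R : realType} (m : nat) (x r : R) : R :=
  1 - (1 + x) `^ (- (m%:R / ln (1 + r))).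

(* Measurability is part of the definition, so that [P] is only evaluated on
   measurable sets. *)
Definition cvg_in_probability {R : realType} {d : measure_display}
    {T : measurableType d} (P : probability T R) (Y : nat -> T -> R) (c : R) :
    Prop :=
  (forall n, measurable_fun [set: T] (Y n)) /\
  (forall e : R, 0 < e -> P [set w | e < `|Y n w - c|] @[n --> \oo] --> 0%E).

(* Main.v *)
Require Import Defs.
From HB Require Import structures.
From mathcomp Require Import all_boot all_order all_algebra finmap.
From mathcomp Require Import all_classical all_reals all_analysis.
From mathcomp Require Import measurable_realfun ring lra.

Set Implicit Arguments.
Unset Strict Implicit.
Unset Printing Implicit Defensive.

Import Order.TTheory GRing.Theory Num.Theory.
Import numFieldNormedType.Exports.

Local Open Scope classical_set_scope.
Local Open Scope ring_scope.

(** The estimator is consistent because the record values have exponential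
increments on a logarithmic scale: given R_k = u, the next record has the law
of an observation conditioned to exceed u, so ln (1 + R_m) behaves as a sum of
m independent exponential variables of mean theta.  The proof does not
establish this representation; it extracts from it the exponential moments that
a Chernoff bound needs.

Fix s < 1 / theta.  For the Lomax density, the integral of (1 + x)^s over
x > u is (1 - theta s)^-1 (1 + u)^(s - 1/theta) ([lomax_power_tail]), and the
survival function at u is (1 + u)^(-1/theta).  Hence, if C_n counts the records
among the first n observations and M_n is the last of them, the process
(1 - theta s)^(C_n) (1 + M_n)^s is a martingale with mean 1
([lomax_power_step], [expectation_record_potential]).  This uses observation
n only through its independence of the pair (C_n, M_n), a pair that is computed
recursively from earlier observations; independence is propagated along this
recursion by the uniqueness of product measures
([independent_of_future_step]), and Fubini integrates the new observation out
([ge0_integral_joint_law]).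

Stopping the process at the m-th record, Markov's inequality at time n and then
n going to infinity bound (1 - theta s)^m (1 + R_m)^s in probability
([upper_record_chernoff]).  The passage to the limit needs that the m-th record
exists almost surely, which holds because observations are almost surely
unbounded ([negligible_degenerate_sample]).  The choice s = 1/theta - 1/a is
optimal and serves both tails at once, for a > theta and for a < theta: it gives
the bound (z e^(1-z))^m with z = a / theta ([ln_upper_record_tail]), and
z e^(1-z) < 1 as soon as z differs from 1.  This is the consistency of
the estimator of theta; the two other estimators are continuous functions of it,
so [cvg_in_probability_continuous] concludes. *)

(** * Integration against a density *)

Section integral_density.
Import HBNNSimple.

(** The hypothesis is the case of indicator functions; linearity extends it to
simple functions and monotone convergence to nonnegative functions. *)
Lemma ge0_integral_density {R : realType} {d : measure_display}
    {T : measurableType d} (mu nu : {measure set T -> \bar R}) (p : T -> R)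
    (f : T -> \bar R) :
  measurable_fun [set: T] p -> (forall x, 0 <= p x) ->
  (forall A, measurable A -> nu A = (\int[mu]_(x in A) (p x)%:E)%E) ->
  measurable_fun [set: T] f -> (forall x, (0 <= f x)%E) ->
  (\int[nu]_x f x = \int[mu]_x (f x * (p x)%:E))%E.
Proof.
move=> mp p0 nuE mf f0.
have mpE : measurable_fun [set: T] (fun x => (p x)%:E).
  exact/measurable_EFinP.
pose g := nnsfun_approx measurableT mf.
have g_cvg x : (g n x)%:E @[n --> \oo] --> f x by apply: cvg_nnsfun_approx.
have mg n : measurable_fun [set: T] (fun x => (g n x)%:E).
  exact/measurable_EFinP.
have g_nd x : {homo (fun n => (g n x)%:E) : m n / (m <= n)%N >-> (m <= n)%E}.
  by move=> m n mn; rewrite lee_fin; exact/lefP/nd_nnsfun_approx.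
have g0 n x : (0 <= (g n x)%:E)%E by rewrite lee_fin.
have pE0 x : (0 <= (p x)%:E)%E by rewrite lee_fin.
transitivity (limn (fun n => \int[nu]_x (g n x)%:E)%E).
  rewrite -monotone_convergence//.
  by apply: eq_integral => x _; apply/esym/cvg_lim.
transitivity (limn (fun n => \int[mu]_x ((g n x)%:E * (p x)%:E))%E); last first.
  rewrite -monotone_convergence//.
  - apply: eq_integral => x _; apply/cvg_lim => //.
    by apply: cvgeZr => //.
  - by move=> n; exact: emeasurable_funM.
  - by move=> n x _; exact: mule_ge0.
  - by move=> x _ m n mn; apply: lee_wpmul2r => //; exact: g_nd.
congr (limn _); apply/funext => n.
pose h r x : \bar R := (r * \1_(g n @^-1` [set r]) x)%:E.
have hE x : ((g n x)%:E = \sum_(r \in range (g n)) h r x)%E.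
  by rewrite {1}fimfunE -fsumEFin.
have mh r : measurable_fun [set: T] (h r).
  exact/measurable_EFinP/measurable_funM.
have h0 r x : (0 <= h r x)%E by rewrite /h nnfun_muleindic_ge0.
under eq_integral do rewrite hE.
rewrite ge0_integral_fsum//.
transitivity
  (\int[mu]_x (\sum_(r \in range (g n)) h r x * (p x)%:E))%E; last first.
  apply: eq_integral => x _; rewrite hE ge0_mule_fsuml//.
rewrite ge0_integral_fsum//; last 2 first.
- by move=> r; exact: emeasurable_funM.
- by move=> r x _; exact: mule_ge0.
apply: eq_fsbigr => r /[!inE] -[x0 _ <-{r}].
rewrite integralZl_indic_nnsfun// integral_indic// setIT nuE// /h.
under [RHS]eq_integral do rewrite EFinM -muleA.
rewrite ge0_integralZl_EFin//; last 2 first.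
- by move=> x _; rewrite mule_ge0// lee_fin.
- by apply: emeasurable_funM => //; exact/measurable_EFinP.
congr (_ * _)%E; rewrite integral_mkcond; apply: eq_integral => x _.
rewrite patchE indicE; case: ifPn => _; by rewrite ?mul1e ?mul0e.
Qed.

End integral_density.

(** * States independent of the observations to come *)

Section independence.
Context {R : realType} {d : measure_display} {T : measurableType d}
  {P : probability T R}.
Variable X : nat -> {RV P >-> R}.

Definition cylinder (J : {fset nat}) (A : nat -> set R) : set T :=
  \bigcap_(i in [set` J]) (X i @^-1` A i).

Lemma measurable_cylinder J A : (forall i, measurable (A i)) ->
  measurable (cylinder J A).
Proof.
move=> mA; rewrite /cylinder.
apply: bigcap_measurableType => //.
by move=> i _; rewrite -[X in measurable X]setTI; exact: measurable_funPT.
Qed.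

(** The cylinders over indices at least [n] form a pi-system that generates the
sigma-algebra of the observations from index [n] on, so this is independence of
[U] from that sigma-algebra. *)
Definition independent_of_future {d' : measure_display}
    {S : measurableType d'} (n : nat) (U : T -> S) : Prop :=
  forall (J : {fset nat}) (A : nat -> set R) (B : set S),
    (forall i, measurable (A i)) -> (forall i, i \in J -> (n <= i)%N) ->
    measurable B ->
  P (U @^-1` B `&` cylinder J A) = (P (U @^-1` B) * P (cylinder J A))%E.

Lemma independent_of_future_cst {d' : measure_display}
    {S : measurableType d'} n (u : S) : independent_of_future n (fun=> u).
Proof.
move=> J A B _ _ _; have [uB|uB] := boolP (u \in B).
- rewrite (_ : _ @^-1` B = setT); first by rewrite setTI probability_setT mul1e.
  by apply/seteqP; split=> // w _; rewrite /= -in_setE.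
- rewrite (_ : _ @^-1` B = set0); first by rewrite set0I measure0 mul0e.
  by apply/seteqP; split=> // w /=; rewrite -in_setE (negbTE uB).
Qed.

Lemma cylinder_cons (J : {fset nat}) (A : nat -> set R) n (B : set R) :
  n \notin J ->
  cylinder (n |` J)%fset (fun i => if i == n then B else A i) =
  X n @^-1` B `&` cylinder J A.
Proof.
move=> nJ; apply/seteqP; split=> w.
- move=> h; split.
    by have := h n; rewrite /= eqxx; apply; rewrite !inE eqxx.
  move=> i /= iJ; have := h i; rewrite /= (_ : (i == n) = false).
    by apply; rewrite !inE iJ orbT.
  by apply: contraNF nJ => /eqP <-.
- move=> [hn h] i /=; rewrite !inE => /orP[/eqP ->|iJ]; first by rewrite eqxx.
  case: ifPn => [/eqP ->//|_]; exact: h.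
Qed.

Hypothesis X_indep : mutually_independent X.

Lemma probability_cylinder_cons (J : {fset nat}) (A : nat -> set R) n B :
  (forall i, measurable (A i)) -> measurable B -> n \notin J ->
  P (X n @^-1` B `&` cylinder J A) = (P (X n @^-1` B) * P (cylinder J A))%E.
Proof.
move=> mA mB nJ; rewrite -cylinder_cons// X_indep; last first.
  by move=> i; case: ifP.
rewrite X_indep// big_fsetU1//= eqxx; congr (_ * _)%E.
rewrite big_seq [RHS]big_seq; apply: eq_bigr => i iJ; case: ifPn => // /eqP ni.
by rewrite -ni iJ in nJ.
Qed.

Context {d' : measure_display} {S : measurableType d'}.
Variables (n : nat) (U : {mfun T >-> S}).
Hypothesis U_indep : independent_of_future n U.

Let UX w := (U w, X n w).
Let mUX : measurable_fun [set: T] UX.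
Proof. exact: measurable_fun_pair. Qed.

(** For rectangles this is the product rule; both sides are finite measures in
[C], so uniqueness of the product measure extends it to all measurable sets.
The factor [P (cylinder J A)] is absorbed into the second marginal. *)
Lemma joint_law_future (J : {fset nat}) (A : nat -> set R) (C : set (S * R)) :
  (forall i, measurable (A i)) -> (forall i, i \in J -> (n < i)%N) ->
  measurable C ->
  P (UX @^-1` C `&` cylinder J A) =
  (P (cylinder J A) * (distribution P U \x distribution P (X n)) C)%E.
Proof.
move=> mA Jn mC.
have mE := measurable_cylinder J mA.
have nJ : n \notin J by apply/negP => /Jn; rewrite ltnn.
pose r : {nonneg R} := NngNum (fine_ge0 (measure_ge0 P (cylinder J A))).
have rE : (r%:num)%:E = P (cylinder J A).
  by rewrite /r/= fineK// fin_num_measure.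
pose m0 : {measure set (S * R) -> \bar R} := pushforward (mrestr P mE) UX.
pose m' : {measure set (S * R) -> \bar R} := m0 mUX.
have H : forall B D, measurable B -> measurable D ->
    m' (B `*` D) = (distribution P U B * mscale r (distribution P (X n)) D)%E.
  move=> B D mB mD; rewrite /mscale rE.
  rewrite -[LHS]/(P (U @^-1` B `&` X n @^-1` D `&` cylinder J A)) -setIA.
  rewrite -(cylinder_cons A D nJ).
  rewrite U_indep//; last 2 first.
  - by move=> i; case: ifP.
  - by move=> i; rewrite !inE => /orP[/eqP ->//|/Jn/ltnW].
  rewrite cylinder_cons// probability_cylinder_cons//.
  by congr (_ * _)%E; rewrite muleC.
rewrite -[LHS]/(m' C) -(product_measure_unique H mC).
rewrite /product_measure1 /= /mscale rE /=.
rewrite ge0_integralZl//.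
exact: measurable_fun_xsection.
Qed.

Lemma joint_law (C : set (S * R)) : measurable C ->
  P (UX @^-1` C) = (distribution P U \x distribution P (X n))%E C.
Proof.
move=> mC; have := @joint_law_future fset0 (fun=> setT) C.
rewrite (_ : cylinder _ _ = setT) ?setIT ?probability_setT ?mul1e.
  by apply.
by apply/seteqP; split=> // w _ i /=; rewrite inE.
Qed.

(** A recursion driven by the observations keeps the state independent of the
observations that have not been used yet. *)
Lemma independent_of_future_step d2 (S2 : measurableType d2)
    (G : S * R -> S2) : measurable_fun [set: S * R] G ->
  independent_of_future n.+1 (fun w => G (U w, X n w)).
Proof.
move=> mG J A B mA Jn mB.
have mGB : measurable (G @^-1` B).
  by rewrite -[X in measurable X]setTI; exact: mG.
rewrite -[_ @^-1` B]/(UX @^-1` (G @^-1` B)).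
rewrite (joint_law_future mA Jn mGB) (joint_law mGB).
exact: muleC.
Qed.

(** The new observation can be integrated out with the state frozen: this is
the conditional expectation given the past. *)
Lemma ge0_integral_joint_law (f : S * R -> \bar R) :
  measurable_fun [set: S * R] f -> (forall z, (0 <= f z)%E) ->
  (\int[P]_w f (UX w) =
   \int[P]_w \int[distribution P (X n)]_x f (U w, x))%E.
Proof.
move=> mf f0.
transitivity (\int[pushforward P UX]_z f z)%E.
  by rewrite ge0_integral_pushforward.
transitivity (\int[distribution P U \x distribution P (X n)]_z f z)%E.
  apply: eq_measure_integral => C mC _.
  exact: joint_law.
rewrite fubini_tonelli1// /fubini_F.
rewrite ge0_integral_pushforward//.
  exact: measurable_fun_fubini_tonelli_F.
by move=> x _; exact: integral_ge0.
Qed.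

End independence.

(** * Power moments of the Lomax law *)

Section lomax_integral.
Context {R : realType}.
Implicit Types (theta s x u : R).

Lemma lomax_pdf_ge0 theta x : 0 < theta -> 0 <= lomax_pdf theta x.
Proof.
move=> th0; rewrite /lomax_pdf; case: ifP => // _.
by rewrite mulr_ge0 ?invr_ge0 ?powR_ge0// ltW.
Qed.

Lemma measurable_lomax_pdf theta :
  measurable_fun [set: R] (lomax_pdf theta).
Proof.
apply: measurable_fun_ifT => //; first exact: measurable_fun_ler.
apply: measurable_funM => //.
by apply: (measurableT_comp (measurable_powR _)); exact: measurable_funD.
Qed.

Lemma is_derive_powR1D x a : 0 <= x ->
  is_derive x 1 (fun y => (1 + y) `^ a) (a * (1 + x) `^ (a - 1)).
Proof.
move=> x0; have x1 : 0 < 1 + x by rewrite ltr_wpDr.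
have h : is_derive x 1 (fun y : R => 1 + y) 1.
  by apply: is_derive_eq; rewrite add0r mulr1.
rewrite -[X in is_derive _ _ _ X]mulr1.
exact: (is_derive1_comp
  (is_derive1_powR a x1 : is_derive ((fun y => 1 + y) x) _ _ _) h).
Qed.

Lemma cvgy_powR1DN (b : R) : 0 < b -> (1 + x) `^ (- b) @[x --> +oo] --> 0.
Proof.
move=> b0; apply/cvgrPdist_le => e e0; near=> x.
have x0 : 0 <= x by near: x; exact: nbhs_pinfty_ge.
have ex : (e^-1) `^ b^-1 <= x by near: x; exact: nbhs_pinfty_ge.
rewrite sub0r normrN ger0_norm ?powR_ge0// powRN.
rewrite -[e]invrK lef_pV2 ?posrE ?invr_gt0 ?powR_gt0 ?ltr_wpDr//.
have e1 : 0 <= e^-1 by rewrite invr_ge0 ltW.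
rewrite -[leLHS]powRr1// -[X in _ `^ X <= _](mulVf (lt0r_neq0 b0)) powRrM.
apply: ge0_ler_powR; rewrite ?nnegrE ?powR_ge0 ?addr_ge0//; first exact: ltW.
by rewrite (le_trans ex)// lerDr.
Unshelve. all: by end_near. Qed.

Lemma integral_powR1D (b u : R) : 0 < b -> 0 <= u ->
  (\int[lebesgue_measure]_(x in `[u, +oo[) (b * (1 + x) `^ (- b - 1))%:E =
   ((1 + u) `^ (- b))%:E)%E.
Proof.
move=> b0 u0.
have dF (x : R) : u <= x ->
    is_derive x 1 (fun y => - (1 + y) `^ (- b)) (b * (1 + x) `^ (- b - 1)).
  move=> ux; have x0 := le_trans u0 ux.
  have h := is_derive_powR1D (- b) x0.
  rewrite -[X in is_derive _ _ _ X]opprK -mulNr.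
  exact: is_deriveN.
rewrite (@ge0_continuous_FTC2y _ _ (fun y => - (1 + y) `^ (- b)) _ 0).
- by rewrite sub0e -EFinN opprK.
- by move=> x _; rewrite mulr_ge0 ?powR_ge0// ltW.
- apply: derivable_within_continuous => x; rewrite in_itv/= andbT => ux.
  have h := is_derive_powR1D (- b - 1) (le_trans u0 ux).
  by apply: derivableM => //; case: h.
- by rewrite -oppr0; apply: cvgN; exact: cvgy_powR1DN.
- by move=> x /ltW /dF [].
- apply: cvg_at_right_filter.
  have [d _] := dF u (lexx u).
  by move/derivable1_diffP/differentiable_continuous: d.
- move=> x; rewrite in_itv/= andbT => /ltW /dF h.
  by rewrite derive1E derive_val.
Qed.

End lomax_integral.

(** Truncating at 0 makes the power meaningful on the whole line without
affecting the Lomax law, which lives on the half-line. *)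
Definition lomax_power {R : realType} (s x : R) : R :=
  (1 + Num.max x 0) `^ s.

Section lomax_power.
Context {R : realType} {d : measure_display} {T : measurableType d}
  {P : probability T R}.
Variables (theta : R) (X : {RV P >-> R}).
Hypotheses (theta_gt0 : 0 < theta) (X_lomax : has_lomax_law theta X).

Lemma lomax_power_gt0 s (x : R) : 0 < lomax_power s x.
Proof. by rewrite powR_gt0// ltr_wpDr// le_max lexx orbT. Qed.

Lemma measurable_lomax_power s : measurable_fun [set: R] (lomax_power s).
Proof.
apply: (measurableT_comp (measurable_powR _)) => //.
apply: measurable_funD => //.
exact: measurable_maxr.
Qed.

(** [lebesgue_measure] lives on another copy of the measurable real line than
random variables do, hence the detour through [Y]. *)
Lemma ge0_integral_lomax (f : R -> \bar R) :
  measurable_fun [set: R] f -> (forall x, (0 <= f x)%E) ->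
  (\int[distribution P X]_x f x =
   \int[lebesgue_measure]_x (f x * (lomax_pdf theta x)%:E))%E.
Proof.
move=> mf f0; pose Y : T -> measurableTypeR R := X.
have mX : measurable_fun [set: T] X by [].
have mY : measurable_fun [set: T] Y by move=> mT B mB; exact: mX.
pose m0 : {measure set (measurableTypeR R) -> \bar R} := pushforward P Y.
rewrite ge0_integral_distribution//.
rewrite -(ge0_integral_density (nu := m0 mY) (p := lomax_pdf theta))//.
- by rewrite ge0_integral_pushforward.
- exact: measurable_lomax_pdf.
- by move=> x; exact: lomax_pdf_ge0.
Qed.

(** The product of the power and the density is again a power of [1 + x], of
exponent smaller than -1 exactly when [s < theta^-1]. *)
Lemma lomax_power_tail s (u : R) : s < theta^-1 ->
  (\int[distribution P X]_(x in `]u, +oo[) (lomax_power s x)%:E =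
   ((1 - theta * s)^-1 * lomax_power (s - theta^-1) u)%:E)%E.
Proof.
move=> s_lt; rewrite integral_mkcond.
have mphi := measurable_lomax_power s.
have b_gt0 : 0 < theta^-1 - s by rewrite subr_gt0.
have c_neq0 : 1 - theta * s != 0.
  by rewrite subr_eq0 eq_sym lt_eqF// mulrC -ltr_pdivlMr ?mul1r.
rewrite ge0_integral_lomax.
- set v := Num.max u 0.
  have v0 : 0 <= v by rewrite /v le_max lexx orbT.
  have c_ge0 : 0 <= (1 - theta * s)^-1.
    by rewrite invr_ge0 subr_ge0 ltW// mulrC -ltr_pdivlMr ?mul1r.
  (* up to a constant factor, the integrand on the half-line, normalized so as
     to be minus the derivative of a power *)
  pose g x : \bar R :=
    ((theta^-1 - s) * (1 + x) `^ (- (theta^-1 - s) - 1))%:E.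
  have mg : measurable_fun [set: R] g.
    apply/measurable_EFinP; apply: measurable_funM => //.
    by apply: (measurableT_comp (measurable_powR _)); exact: measurable_funD.
  have g0 x : (0 <= g x)%E by rewrite lee_fin mulr_ge0 ?powR_ge0// ltW.
  transitivity (\int[lebesgue_measure]_(x in `]u, +oo[ `&` `[0%R, +oo[)
                  (((1 - theta * s)^-1)%:E * g x))%E.
    rewrite [RHS]integral_mkcond; apply: eq_integral => x _.
    rewrite !patchE in_setI !mem_setE !in_itv/= !andbT /lomax_pdf.
    case: (u < x) => /=; last by rewrite mul0e.
    case: ifPn => x0; last by rewrite mule0.
    have x1 : 0 < 1 + x by rewrite ltr_wpDr.
    rewrite /g -!EFinM /lomax_power (max_idPl x0) mulrCA -powRD; last first.
      by rewrite (gt_eqF x1) implybT.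
    rewrite mulrA; congr (_ * (_ `^ _))%:E.
      by field; rewrite c_neq0 andbT gt_eqF.
    ring.
  rewrite ge0_integralZl_EFin//; last 2 first.
  - exact: measurableI.
  - exact: measurable_funTS.
  rewrite EFinM; congr (_ * _)%E.
  transitivity (\int[lebesgue_measure]_(x in `[v, +oo[) g x)%E; last first.
    by rewrite integral_powR1D// opprB.
  rewrite /v; have [u0|u0] := ltP u 0.
    congr integral; apply/seteqP; split=> x /=; rewrite !in_itv/= !andbT.
      by case.
    by move=> x0; split=> //; exact: lt_le_trans x0.
  rewrite -integral_itv_obnd_cbnd; last exact: measurable_funTS.
  congr integral; apply/seteqP; split=> x /=; rewrite !in_itv/= !andbT.
    by case.
  by move=> ux; split=> //; rewrite (le_trans u0)// ltW.
- apply/(measurable_restrictT _ _).1 => //.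
  exact/measurable_funTS/measurable_EFinP.
- move=> x; rewrite patchE; case: ifP => // _.
  by rewrite lee_fin ltW ?lomax_power_gt0.
Qed.

Lemma lomax_survival (u : R) :
  distribution P X `]u, +oo[ = (lomax_power (- theta^-1) u)%:E.
Proof.
have := @lomax_power_tail 0 u; rewrite invr_gt0 => /(_ theta_gt0).
rewrite mulr0 subr0 invr1 mul1r sub0r => <-.
rewrite (eq_integral (cst 1%E)) ?integral_cst ?mul1e//.
by move=> x _; rewrite /lomax_power powRr0.
Qed.

(** The identity behind the martingale: an observation beyond [u] multiplies the
conditional mean of the power by [(1 - theta * s)^-1], which the factor
[1 - theta * s] compensates, and the other observations leave [u] unchanged. *)
Lemma lomax_power_step s (u : R) : s < theta^-1 ->
  (\int[distribution P X]_x
     (if u < x then (1 - theta * s) * lomax_power s x else lomax_power s u)%:E =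
   (lomax_power s u)%:E)%E.
Proof.
move=> s_lt.
have c_gt0 : 0 < 1 - theta * s.
  by rewrite subr_gt0 mulrC -ltr_pdivlMr ?mul1r.
have phi0 := lomax_power_gt0.
rewrite -(setUv `]u, +oo[%classic) ge0_integral_setU//=; last 4 first.
- exact: measurableC.
- apply/measurable_EFinP; apply: measurable_funTS.
  apply: measurable_fun_ifT => //; first exact: measurable_fun_ltr.
  by apply: measurable_funM => //; exact: measurable_lomax_power.
- by move=> x _; case: ifP => _; rewrite lee_fin ltW// mulr_gt0.
- exact/disj_setPCl.
rewrite (eq_integral
  (fun x => (1 - theta * s)%:E * (lomax_power s x)%:E)%E); last first.
  by move=> x; rewrite inE/= in_itv/= andbT => ->.
rewrite ge0_integralZl_EFin//; last 3 first.
- by move=> x _; rewrite lee_fin ltW.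
- by apply/measurable_EFinP/measurable_funTS; exact: measurable_lomax_power.
- exact: ltW.
rewrite lomax_power_tail// -EFinM mulVKf ?gt_eqF//.
rewrite (eq_integral (cst (lomax_power s u)%:E)); last first.
  by move=> x; rewrite inE/= in_itv/= andbT => /negP/negbTE ->.
rewrite integral_cst//; last exact: measurableC.
rewrite [X in (_ * X)%E](_ : _ =
    1 - (lomax_power (- theta^-1) u)%:E)%E; last first.
  rewrite -lomax_survival -[LHS]/(distribution P X (~` `]u, +oo[)).
  exact: probability_setC.
rewrite -EFinB -EFinM -EFinD; congr _%:E.
rewrite mulrBr mulr1 -powRD; first by rewrite subrKC.
have u1 : 0 < 1 + Num.max u 0 by rewrite ltr_wpDr// le_max lexx orbT.
by rewrite (gt_eqF u1) implybT.
Qed.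

End lomax_power.

(** * The chain of records *)

Section record_chain.
Context {R : realType}.
Implicit Types (x : nat -> R) (z : nat * R * R).

(** The state is the number of records met so far and the value of the last
one; it no longer moves once [m] records have been met, so the limit of the
chain in time carries the [m]-th record. *)
Definition record_step (m : nat) z : nat * R :=
  if (z.1.1 < m)%N && (z.1.2 < z.2) then (z.1.1.+1, z.2) else z.1.

(** Starting from the value 0 makes the first observation a record as soon as
it is positive, which is almost sure for the Lomax law. *)
Fixpoint record_chain (m : nat) x (n : nat) : nat * R :=
  if n is n'.+1 then record_step m (record_chain m x n', x n') else (0%N, 0).

Lemma next_recordP x t : (exists j : nat, (t < j)%N && (x t < x j)) ->
  [/\ (t < next_record x t)%N, x t < x (next_record x t) &
    forall j, (t < j < next_record x t)%N -> x j <= x t].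
Proof.
move=> ex; rewrite /next_record; case: pselect => // ex'.
case: ex_minnP => t' /andP[tt' xtt'] t'min; split=> // j /andP[tj jt'].
rewrite leNgt; apply/negP => xtj.
by have := t'min j; rewrite tj xtj leqNgt jt' => /(_ isT).
Qed.

Lemma record_chain_ge0 m x n : 0 <= (record_chain m x n).2.
Proof.
elim: n => //= n IHn; rewrite /record_step /=.
by case: ifP => // /andP[_ /ltW]; exact: le_trans.
Qed.

Lemma record_chain_stop m x n n' : (n <= n')%N ->
  (record_chain m x n).1 = m -> record_chain m x n' = record_chain m x n.
Proof.
move=> /subnKC <- cm; elim: (n' - n)%N => [|p IHp]; first by rewrite addn0.
by rewrite addnS /= IHp /record_step /= cm ltnn.
Qed.

Lemma record_chain_constant m x n n' : (n <= n')%N ->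
  (forall j, (n <= j < n')%N -> x j <= (record_chain m x n).2) ->
  record_chain m x n' = record_chain m x n.
Proof.
move=> /subnKC <-; elim: (n' - n)%N => [|p IHp] xn; first by rewrite addn0.
rewrite addnS /= IHp => [|j /andP[nj jp]]; last first.
  by apply: xn; rewrite nj addnS ltnS ltnW.
by rewrite /record_step /= [_ < x _]ltNge xn ?andbF// leq_addr addnS leqnn.
Qed.

(** Between two record times the chain is constant, since no observation there
exceeds the last record. *)
Lemma record_chain_record_time m x k : 0 < x 0%N ->
  (forall t, exists j : nat, (t < j)%N && (x t < x j)) -> (k < m)%N ->
  record_chain m x (record_time x k.+1).+1 = (k.+1, x (record_time x k.+1)).
Proof.
move=> x0 x_io; rewrite /record_time /=; elim: k => [|k IHk] km.
  by rewrite /= /record_step /= km x0.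
set t := iter k _ _ in IHk *.
have {}IHk : record_chain m x t.+1 = (k.+1, x t) := IHk (ltnW km).
have [tt' xt' x_le] := next_recordP (x_io t).
rewrite iterS -/t.
have E : record_chain m x (next_record x t) = (k.+1, x t).
  by rewrite (record_chain_constant tt') IHk.
by rewrite /= E /record_step /= km xt'.
Qed.

Lemma record_chain_upper_record m x : (0 < m)%N -> 0 < x 0%N ->
  (forall t, exists j : nat, (t < j)%N && (x t < x j)) ->
  exists n, record_chain m x n = (m, x (record_time x m)).
Proof.
case: m => // m _ x0 x_io; exists (record_time x m.+1).+1.
exact: record_chain_record_time.
Qed.

Lemma measurable_record_step m :
  measurable_fun [set: nat * R * R] (record_step m).
Proof.
have m11 : measurable_fun [set: nat * R * R] (fun z => z.1.1).
  by apply: measurableT_comp => //; exact: measurable_fst.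
have m12 : measurable_fun [set: nat * R * R] (fun z => z.1.2).
  by apply: measurableT_comp => //; exact: measurable_snd.
have m2 : measurable_fun [set: nat * R * R] (fun z => z.2).
  exact: measurable_snd.
apply: measurable_fun_ifT.
- apply: measurable_and; last exact: measurable_fun_ltr.
  exact: measurable_fun_ltn.
- apply: measurable_fun_pair => //.
  exact: (@measurableT_comp _ _ _ _ _ _ S).
- exact: measurable_fst.
Qed.

End record_chain.

Section upper_record_measurable.
Context {R : realType} {d : measure_display} {T : measurableType d}.
Variables (X : nat -> T -> R).
Hypothesis mX : forall i, measurable_fun [set: T] (X i).

Let measurable_lt i j : measurable [set w | X i w < X j w].
Proof.
rewrite -[X in measurable X]setTI -[X in _ `&` X]preimage_true.
exact: measurable_fun_ltr.
Qed.

(** The event is a countable combination of comparisons between two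
observations; for [t' = t] it says that no record follows [t]. *)
Lemma measurable_next_record t t' :
  measurable [set w | next_record (X^~ w) t = t'].
Proof.
have mle D : measurable (\bigcap_(j in D) ~` [set w | X t w < X j w]).
  by apply: bigcap_measurableType => j _; exact: measurableC.
have [tt'|t't] := ltnP t t'.
  rewrite (_ : [set _ | _] = [set w | X t w < X t' w] `&`
      \bigcap_(j in [set j | (t < j < t')%N]) ~` [set w | X t w < X j w]).
    exact: measurableI.
  apply/seteqP; split=> w.
  - move=> /= nt'; have [ex|nex] := pselect (exists j : nat,
        (t < j)%N && (X t w < X j w)); last first.
      by move: nt' tt'; rewrite /next_record; case: pselect => // _ ->;
        rewrite ltnn.
    have [_] := next_recordP ex; rewrite nt' => xt' x_le; split=> // j /= /x_le.
    by move=> xj; apply/negP; rewrite -leNgt.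
  - move=> [/= xt' x_le].
    have ex : exists j : nat, (t < j)%N && (X t w < X j w).
      by exists t'; rewrite tt'.
    have [tn xn xn_le] := next_recordP ex.
    apply/eqP; rewrite eqn_leq; apply/andP; split; rewrite leqNgt; apply/negP.
      by move=> t'n; have := xn_le t'; rewrite tt' t'n leNgt xt' => /(_ isT).
    by move=> nt'; apply: (x_le (next_record (X^~ w) t)) => //=; rewrite tn.
rewrite (_ : [set _ | _] = if t == t' then
    \bigcap_(j in [set j | (t < j)%N]) ~` [set w | X t w < X j w] else set0).
  by case: ifP.
apply/seteqP; split=> w /=.
- move=> nt'; have [ex|nex] := pselect (exists j : nat,
        (t < j)%N && (X t w < X j w)).
    by have [] := next_recordP ex; rewrite nt' ltnNge t't.
  move: nt'; rewrite /next_record; case: pselect => // _ <-; rewrite eqxx.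
  by move=> j /= tj xj; apply: nex; exists j; rewrite tj.
- case: eqP => // <- x_le; rewrite /next_record; case: pselect => // ex.
  by have [j /andP[tj xj]] := ex; case: (x_le j tj).
Qed.

Lemma measurable_record_time m t :
  measurable [set w | record_time (X^~ w) m = t].
Proof.
rewrite /record_time; elim: m.-1 t => [|k IHk] t /=.
  have [<-|t0] := eqVneq 0%N t.
    by rewrite (_ : [set _ | _] = setT) // -subTset.
  rewrite (_ : [set _ | _] = set0)//; apply/seteqP; split=> // w /= /eqP.
  by rewrite (negbTE t0).
rewrite (_ : [set _ | _] = \bigcup_s
    ([set w | iter k (next_record (X^~ w)) 0%N = s] `&`
     [set w | next_record (X^~ w) s = t])).
  by apply: bigcupT_measurable => s; apply: measurableI => //;
    exact: measurable_next_record.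
apply/seteqP; split=> w /=; last by move=> [s _ [/= -> ->]].
by move=> <-; exists (iter k (next_record (X^~ w)) 0%N).
Qed.

Lemma measurable_upper_record m : measurable_fun [set: T] (upper_record X m).
Proof.
move=> _ B mB; rewrite setTI.
rewrite (_ : _ @^-1` B = \bigcup_t
    ([set w | record_time (X^~ w) m = t] `&` X t @^-1` B)).
  apply: bigcupT_measurable => t; apply: measurableI.
    exact: measurable_record_time.
  by rewrite -[X in measurable X]setTI; exact: mX.
apply/seteqP; split=> w /=; last by move=> [t _ [/= <-]].
by move=> Bw; exists (record_time (X^~ w) m).
Qed.

End upper_record_measurable.

(** * The record martingale *)

Section record_martingale.
Context {R : realType} {d : measure_display} {T : measurableType d}
  {P : probability T R}.
Variables (theta : R) (X : nat -> {RV P >-> R}).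
Hypotheses (theta_gt0 : 0 < theta) (X_indep : mutually_independent X)
  (X_lomax : forall i, has_lomax_law theta (X i)).

Definition sample_chain (m n : nat) (w : T) : nat * R :=
  record_chain m (fun i => X i w) n.

Lemma measurable_sample_chain m n : measurable_fun [set: T] (sample_chain m n).
Proof.
elim: n => [|n IHn]; first exact: measurable_cst.
apply: (measurableT_comp (measurable_record_step m)).
exact: measurable_fun_pair.
Qed.

HB.instance Definition _ m n :=
  isMeasurableFun.Build _ _ _ _ (sample_chain m n)
    (measurable_sample_chain m n).

Lemma sample_chain_indep m n : independent_of_future X n (sample_chain m n).
Proof.
elim: n => [|n IHn]; first exact: independent_of_future_cst.
exact: (independent_of_future_step X_indep IHn (measurable_record_step m)).
Qed.

Definition record_potential (s : R) (z : nat * R) : R :=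
  (1 - theta * s) ^+ z.1 * lomax_power s z.2.

Lemma measurable_record_potential s :
  measurable_fun [set: nat * R] (record_potential s).
Proof.
apply: measurable_funM.
  by apply: (@measurableT_comp _ _ _ _ _ _ (fun k => (1 - theta * s) ^+ k)).
apply: (measurableT_comp (measurable_lomax_power s)); exact: measurable_snd.
Qed.

Section moment.
Variable s : R.
Hypothesis s_lt : s < theta^-1.

Let c_gt0 : 0 < 1 - theta * s.
Proof. by rewrite subr_gt0 mulrC -ltr_pdivlMr ?mul1r. Qed.

Lemma record_potential_gt0 z : 0 < record_potential s z.
Proof. by rewrite mulr_gt0 ?exprn_gt0 ?lomax_power_gt0. Qed.

Lemma record_potential_step m i (z : nat * R) :
  (\int[distribution P (X i)]_x (record_potential s (record_step m (z, x)))%:E =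
   (record_potential s z)%:E)%E.
Proof.
rewrite /record_step /=; case: z => k u /=.
have [km|km] := boolP (k < m)%N; last first.
  rewrite (eq_integral (cst (record_potential s (k, u))%:E))//.
  by rewrite integral_cst//= probability_setT mule1.
have phi0 := lomax_power_gt0 s.
transitivity (\int[distribution P (X i)]_x (((1 - theta * s) ^+ k)%:E *
  (if u < x then (1 - theta * s) * lomax_power s x else lomax_power s u)%:E))%E.
  apply: eq_integral => x _; rewrite andTb -EFinM /record_potential.
  by case: ifP => _ //=; rewrite exprSr mulrA.
rewrite ge0_integralZl_EFin//.
- by rewrite (lomax_power_step theta_gt0 (X_lomax i)).
- by move=> x _; case: ifP => _; rewrite lee_fin ltW// mulr_gt0.
- apply/measurable_EFinP; apply: measurable_fun_ifT => //.
    exact: measurable_fun_ltr.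
  by apply: measurable_funM => //; exact: measurable_lomax_power.
- by rewrite exprn_ge0// ltW.
Qed.

(** The potential of the chain is a martingale, of initial value 1. *)
Lemma expectation_record_potential m n :
  (\int[P]_w (record_potential s (sample_chain m n w))%:E = 1)%E.
Proof.
elim: n => [|n IHn] /=.
  rewrite (eq_integral (cst 1%E)).
    by rewrite integral_cst// mul1e; exact: probability_setT.
  move=> w _; rewrite /record_potential /= expr0 mul1r /lomax_power.
  by rewrite maxxx addr0 powR1.
rewrite -IHn.
rewrite (ge0_integral_joint_law X_indep (@sample_chain_indep m n)
  (f := fun z => (record_potential s (record_step m z))%:E)).
- by apply: eq_integral => w _; rewrite record_potential_step.
- apply/measurable_EFinP.
  apply: (measurableT_comp (measurable_record_potential s)).
  exact: measurable_record_step.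
- by move=> z; rewrite lee_fin ltW// record_potential_gt0.
Qed.

Lemma record_potential_markov m n (a : R) : 0 < a ->
  (P [set w | (a <= record_potential s (sample_chain m n w))%R] <= (a^-1)%:E)%E.
Proof.
move=> a0.
have mV : measurable_fun [set: T]
    (fun w => record_potential s (sample_chain m n w)).
  exact: (measurableT_comp (measurable_record_potential s)).
have mA : measurable [set w | a <= record_potential s (sample_chain m n w)].
  rewrite -[X in measurable X]setTI -[X in _ `&` X]preimage_true.
  exact: measurable_fun_ler.
have V0 w : (0 <= (record_potential s (sample_chain m n w))%:E)%E.
  by rewrite lee_fin ltW// record_potential_gt0.
rewrite -(@lee_pmul2l _ a%:E)// -EFinM divff ?gt_eqF//.
rewrite -(expectation_record_potential m n) -integral_cst//.
apply: (@le_trans _ _ (\int[P]_(w in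
   [set w | (a <= record_potential s (sample_chain m n w))%R])
   (record_potential s (sample_chain m n w))%:E)%E).
  apply: ge0_le_integral => //.
  - by move=> w _; rewrite lee_fin ltW.
  - by apply: measurable_funTS; exact/measurable_EFinP.
apply: ge0_subset_integral => //.
exact/measurable_EFinP.
Qed.

End moment.

End record_martingale.

(** * Exponential tail bounds for the records *)

Section record_tail.
Context {R : realType} {d : measure_display} {T : measurableType d}
  {P : probability T R}.
Variables (theta : R) (X : nat -> {RV P >-> R}).
Hypotheses (theta_gt0 : 0 < theta) (X_indep : mutually_independent X)
  (X_lomax : forall i, has_lomax_law theta (X i)).

Lemma probability_le_lomax i (u : R) :
  P (X i @^-1` `]-oo, u]) = (1 - lomax_power (- theta^-1) u)%:E.
Proof.
rewrite EFinB -(lomax_survival theta_gt0 (X_lomax i)).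
rewrite -[LHS]/(distribution P (X i) `]-oo, u]) -setCitvr.
exact: probability_setC.
Qed.

Lemma lomax_power_survival_le1 (u : R) : lomax_power (- theta^-1) u <= 1.
Proof.
rewrite /lomax_power powRN invf_le1; last first.
  by rewrite powR_gt0// ltr_wpDr// le_max lexx orbT.
rewrite -[leLHS](powRr0 (1 + Num.max u 0)).
rewrite ler_powR ?invr_ge0 ?(ltW theta_gt0)//.
by rewrite lerDl le_max lexx orbT.
Qed.

Lemma exists_cylinder_le (u : R) n p : exists J : {fset nat},
  (forall i, i \in J -> (n <= i)%N) /\
  P (cylinder X J (fun=> `]-oo, u]%classic)) =
    ((1 - lomax_power (- theta^-1) u) ^+ p)%:E.
Proof.
elim: p n => [|p IHp] n.
  exists fset0; split=> //; rewrite (_ : cylinder _ _ _ = setT).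
    exact: probability_setT.
  by apply/seteqP; split=> // w _ i /=; rewrite inE.
have [J [Jn JE]] := IHp n.+1; exists (n |` J)%fset; split.
  by move=> i; rewrite !inE => /orP[/eqP ->//|/Jn/ltnW].
have nJ : n \notin J by apply/negP => /Jn; rewrite ltnn.
have := cylinder_cons X (fun=> `]-oo, u]%classic) `]-oo, u]%classic nJ.
rewrite (_ : (fun i => _) = (fun=> `]-oo, u]%classic)); last first.
  by apply/funext => i; case: ifP.
move=> ->; rewrite probability_cylinder_cons// JE probability_le_lomax.
by rewrite -EFinM exprS.
Qed.

(** For each [p], the event is contained in one about [p] observations only,
whose probability is the [p]-th power of a number smaller than 1. *)
Lemma negligible_bounded (u : R) n :
  P.-negligible [set w | forall j, (n <= j)%N -> X j w <= u].
Proof.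
set q := 1 - lomax_power (- theta^-1) u.
have q0 : 0 <= q by rewrite subr_ge0 lomax_power_survival_le1.
have q1 : q < 1 by rewrite ltrBlDr ltrDl lomax_power_gt0.
have mA : measurable [set w | forall j, (n <= j)%N -> X j w <= u].
  rewrite (_ : [set _ | _] = \bigcap_(j in [set j | (n <= j)%N])
      X j @^-1` `]-oo, u]).
    apply: bigcap_measurableType => j _.
    by rewrite -[X in measurable X]setTI; exact: measurable_funP.
  by apply/seteqP; split=> w h j nj; have := h j nj; rewrite /= in_itv/=.
apply/negligibleP => //; apply/eqP; rewrite eq_le measure_ge0 andbT.
have q_cvg : (q ^+ p)%:E @[p --> \oo] --> (0 : \bar R)%E.
  by apply: cvg_EFin; [exact: nearW|apply: cvg_expr; rewrite ger0_norm].
apply: (cvge_to_ge q_cvg); apply: nearW => p.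
have [J [Jn <-]] := exists_cylinder_le u n p.
apply: le_measure; rewrite ?inE//; first exact: measurable_cylinder.
by move=> w h i /= iJ; rewrite in_itv/=; exact/h/Jn.
Qed.

Lemma negligible_le0 i : P.-negligible [set w | X i w <= 0].
Proof.
rewrite (_ : [set _ | _] = X i @^-1` `]-oo, 0]); last first.
  by apply/seteqP; split=> w /=; rewrite in_itv.
apply/negligibleP.
  by rewrite -[X in measurable X]setTI; exact: measurable_funP.
have := probability_le_lomax i 0.
by rewrite /lomax_power maxxx addr0 powR1 subrr.
Qed.

(** Outside this event the first observation is a record of the chain and, the
observations being unbounded, every observation is eventually exceeded. *)
Definition degenerate_sample : set T :=
  [set w | X 0%N w <= 0] `|`
  \bigcup_n \bigcup_k [set w | forall j, (n <= j)%N -> X j w <= k%:R].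

Lemma negligible_degenerate_sample : P.-negligible degenerate_sample.
Proof.
apply: negligibleU; first exact: negligible_le0.
apply: negligible_bigcup => n; apply: negligible_bigcup => k.
exact: negligible_bounded.
Qed.

Lemma next_record_exists w t : ~ degenerate_sample w ->
  exists j : nat, (t < j)%N && (X t w < X j w).
Proof.
move=> wN; apply: contrapT => nex; apply: wN; right; exists t.+1 => //.
exists (Num.truncn `|X t w|).+1 => // j tj; apply: (@le_trans _ _ (X t w)).
  by rewrite leNgt; apply/negP => xj; apply: nex; exists j; rewrite tj.
rewrite (le_trans (ler_norm _))// ltW//; exact: truncnS_gt.
Qed.

(** The chain stopped at [m] records reaches [R_m] almost surely, so the event
is contained, up to a negligible set, in the increasing union over the time [n]
of the events that the chain has stopped by then with a large potential;
Markov's inequality bounds all of these alike. *)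
Lemma upper_record_chernoff (s b : R) m : (0 < m)%N -> s < theta^-1 ->
  (P [set w | (s * b <= s * ln (1 + upper_record X m w))%R] <=
   (((1 - theta * s) ^+ m * expR (s * b))^-1)%:E)%E.
Proof.
move=> m0 s_lt.
have c_gt0 : 0 < 1 - theta * s.
  by rewrite subr_gt0 mulrC -ltr_pdivlMr ?mul1r.
set a := _ * expR _; have a0 : 0 < a by rewrite mulr_gt0 ?exprn_gt0 ?expR_gt0.
set E := [set w | _].
have mE : measurable E.
  rewrite -[X in measurable X]setTI -[X in _ `&` X]preimage_true.
  apply: measurable_fun_ler => //; apply: measurable_funM => //.
  have mR : measurable_fun [set: T] (fun w => 1 + upper_record X m w).
    apply: measurable_funD => //; exact: measurable_upper_record.
  exact: (measurableT_comp (@measurable_ln R) mR).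
have mchain n : measurable_fun [set: T] (sample_chain X m n).
  exact: measurable_sample_chain.
have mV n : measurable_fun [set: T]
    (fun w => record_potential theta s (sample_chain X m n w)).
  exact: (measurableT_comp (measurable_record_potential theta s) (mchain n)).
pose F n : set T := [set w | (sample_chain X m n w).1 = m /\
  a <= record_potential theta s (sample_chain X m n w)].
have mF n : measurable (F n).
  rewrite (_ : F n = sample_chain X m n @^-1` [set z | z.1 = m] `&`
    (record_potential theta s \o sample_chain X m n) @^-1` `[a, +oo[);
    last first.
    by apply/seteqP; split=> w /=; rewrite /F /= in_itv/= andbT.
  apply: measurableI.
  - rewrite -[X in measurable X]setTI; apply: (mchain n measurableT).
    rewrite (_ : [set _ | _] = fst @^-1` [set m])// -[X in measurable X]setTI.
    exact: measurable_fst.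
  - rewrite -[X in measurable X]setTI.
    exact: (mV n).
have F_nd : {homo F : n p / (n <= p)%N >-> (n <= p)%O}.
  move=> n p np; apply/subsetPset => w [cm Va].
  by rewrite /F /= /sample_chain (record_chain_stop np cm).
have EF : E `<=` degenerate_sample `|` \bigcup_n F n.
  move=> w Ew; have [wN|wN] := pselect (degenerate_sample w); [by left|right].
  have x0 : 0 < X 0%N w.
    by rewrite ltNge; apply/negP => x0; apply: wN; left.
  have [n chainE] := @record_chain_upper_record _ m (fun i => X i w) m0 x0
    (fun t => next_record_exists t wN).
  exists n => //; rewrite /F /= /sample_chain chainE /=; split=> //.
  have r0 : 0 <= upper_record X m w.
    by have := record_chain_ge0 m (fun i => X i w) n; rewrite chainE.
  rewrite /record_potential /= /a.
  apply: ler_wpM2l; first by rewrite exprn_ge0// ltW.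
  rewrite /lomax_power -[X _ w]/(upper_record X m w) (max_idPl r0).
  have r1 : 0 < 1 + upper_record X m w by rewrite ltr_wpDr.
  rewrite /powR (gt_eqF r1) ler_expR.
  exact: Ew.
have mUF : measurable (\bigcup_n F n) by exact: bigcupT_measurable.
have [N [mN N0 sN]] := negligible_degenerate_sample.
have EN : E `<=` N `|` \bigcup_n F n.
  by move=> w /EF [/sN|]; [left|right].
apply: (@le_trans _ _ (P (N `|` \bigcup_n F n))).
  by apply: le_measure; rewrite ?inE//; exact: measurableU.
apply: (@le_trans _ _ (P N + P (\bigcup_n F n))%E).
  exact: measureU2.
rewrite N0 add0e.
apply: (cvge_to_le (nondecreasing_cvg_mu mF mUF F_nd)); apply: nearW => n /=.
apply: le_trans (record_potential_markov theta_gt0 X_indep X_lomax s_lt m n a0).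
apply: le_measure; rewrite ?inE//; last by move=> w [].
rewrite -[X in measurable X]setTI -[X in _ `&` X]preimage_true.
exact: measurable_fun_ler.
Qed.

(** The sign of [a - theta] selects the tail: the event is the upper tail at
[m * a] if [theta < a], and the lower tail if [a < theta]. *)
Lemma ln_upper_record_tail (a : R) m : 0 < a -> (0 < m)%N ->
  (P [set w | ((a - theta) * (m%:R * a) <=
               (a - theta) * ln (1 + upper_record X m w))%R] <=
   ((a / theta * expR (1 - a / theta)) ^+ m)%:E)%E.
Proof.
(* this exponent minimizes the bound; it has the sign of [a - theta] *)
move=> a0 m0; pose s := theta^-1 - a^-1.
have s_lt : s < theta^-1 by rewrite ltrBlDr ltrDl invr_gt0.
have ta : 0 < (theta * a)^-1 by rewrite invr_gt0 mulr_gt0.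
have tn0 : theta != 0 by rewrite gt_eqF.
have an0 : a != 0 by rewrite gt_eqF.
have sE : s = (theta * a)^-1 * (a - theta).
  by rewrite /s; field; rewrite tn0 an0.
rewrite (_ : [set _ | _] =
    [set w | s * (m%:R * a) <= s * ln (1 + upper_record X m w)]); last first.
  by apply/seteqP; split=> w /=; rewrite sE -!(mulrA (_^-1)) (ler_pM2l ta).
apply: (le_trans (upper_record_chernoff _ m0 s_lt)).
rewrite lee_fin (_ : 1 - theta * s = theta / a); last first.
  by rewrite /s; field; rewrite tn0 an0.
rewrite (_ : s * (m%:R * a) = (a / theta - 1) * m%:R); last first.
  by rewrite /s; field; rewrite tn0 an0.
rewrite expRM_natr -exprMn -exprVn invfM invf_div -expRN opprB.
exact: lexx.
Qed.

End record_tail.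

(** * Convergence in probability *)

Lemma measurable_inv {R : realType} : measurable_fun [set: R] (@GRing.inv R).
Proof.
have D0 : open (~` [set (0 : R)]) by exact/closed_openC/closed_eq.
rewrite -(setUv [set (0 : R)]); apply/measurable_funU => //.
- exact: measurableC.
- split; first exact: measurable_fun_set1.
  apply: open_continuous_measurable_fun => // x.
  by rewrite inE /= => /eqP x0; exact: inv_continuous.
Qed.

Section convergence_in_probability.
Context {R : realType} {d : measure_display} {T : measurableType d}.
Variable P : probability T R.

Lemma measurable_deviation (Y : T -> R) (c e : R) :
  measurable_fun [set: T] Y -> measurable [set w | e < `|Y w - c|].
Proof.
move=> mY; rewrite -[X in measurable X]setTI -[X in _ `&` X]preimage_true.
apply: measurable_fun_ltr => //; apply: measurableT_comp => //.
exact: measurable_funB.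
Qed.

Lemma cvg_in_probability_continuous (Y : nat -> T -> R) (c : R) (g : R -> R) :
  measurable_fun [set: R] g -> {for c, continuous g} ->
  cvg_in_probability P Y c ->
  cvg_in_probability P (fun n w => g (Y n w)) (g c).
Proof.
move=> mg gc [mY Yc]; have mgY n : measurable_fun [set: T] (fun w => g (Y n w)).
  exact: measurableT_comp.
split=> // e e0.
have /cvgrPdist_le /(_ e e0) /nbhs_ballP[r /= r0 gr] := gc.
have r2 : 0 < r / 2 by rewrite divr_gt0.
apply: (squeeze_cvge _ (@cvg_cst _ 0%E _ _ _) (Yc _ r2)).
apply: nearW => n; rewrite measure_ge0 /=.
apply: le_measure; rewrite ?inE; [exact: measurable_deviation..|].
move=> w /=; apply: contraTT; rewrite -!leNgt => Yr.
rewrite distrC; apply: gr; rewrite /ball /= distrC.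
by rewrite (le_lt_trans Yr)// ltr_pdivrMr// ltr_pMr// ltr1n.
Qed.

End convergence_in_probability.

(** This is the strict convexity inequality [1 + y < expR y] at [y = z - 1]. *)
Lemma chernoff_rate_lt1 {R : realType} (z : R) : 0 < z -> z != 1 ->
  `|z * expR (1 - z)| < 1.
Proof.
move=> z0 z1; rewrite ger0_norm ?mulr_ge0 ?expR_ge0 ?(ltW z0)//.
rewrite -opprB expRN -[ltRHS](divff (lt0r_neq0 (expR_gt0 (z - 1)))).
rewrite ltr_pM2r ?invr_gt0 ?expR_gt0//.
by rewrite -[ltLHS](subrK 1) addrC expR_gt1Dx// subr_eq0.
Qed.

(** * Consistency of the estimators *)

Section consistency.
Context {R : realType} {d : measure_display} {T : measurableType d}
  {P : probability T R}.
Variables (theta : R) (X : nat -> {RV P >-> R}).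
Hypotheses (theta_gt0 : 0 < theta) (X_indep : mutually_independent X)
  (X_lomax : forall i, has_lomax_law theta (X i)).

Lemma measurable_theta_records m :
  measurable_fun [set: T] (fun w => theta_records m (upper_record X m w)).
Proof.
apply: measurable_funM => //.
have mR : measurable_fun [set: T] (fun w => 1 + upper_record X m w).
  by apply: measurable_funD => //; exact: measurable_upper_record.
exact: (measurableT_comp (@measurable_ln R) mR).
Qed.

Lemma theta_records_consistent :
  cvg_in_probability P (fun m w => theta_records m (upper_record X m w)) theta.
Proof.
split=> [m|e e0]; first exact: measurable_theta_records.
(* the lower tail is estimated at [theta - e'], which has to be positive *)
pose e' := Num.min e (theta / 2).
have e'0 : 0 < e' by rewrite lt_min e0 divr_gt0.
have e'th : e' < theta.
  by rewrite gt_min ltr_pdivrMr// ltr_pMr// ltr1n orbT.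
pose r a := a / theta * expR (1 - a / theta).
have r_cvg a : 0 < a -> a != theta ->
    (r a ^+ m)%:E @[m --> \oo] --> (0 : \bar R)%E.
  move=> a0 ath; apply: cvg_EFin; first exact: nearW.
  apply/cvg_expr/chernoff_rate_lt1; first exact: divr_gt0.
  rewrite -subr_eq0 -(divff (lt0r_neq0 theta_gt0)) -mulrBl.
  by rewrite mulf_neq0 ?invr_eq0 ?subr_eq0// gt_eqF.
pose up := theta + e'; pose lo := theta - e'.
have up0 : 0 < up by exact: addr_gt0.
have lo0 : 0 < lo by rewrite subr_gt0.
have upth : up != theta by rewrite gt_eqF// ltrDl.
have loth : lo != theta by rewrite lt_eqF// ltrBlDr ltrDl.
have sum_cvg :
    ((r up ^+ m)%:E + (r lo ^+ m)%:E)%E @[m --> \oo] --> (0 : \bar R)%E.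
  by rewrite -[X in _ --> X]adde0; apply: cvgeD => //; exact: r_cvg.
apply: (squeeze_cvge _ (@cvg_cst _ 0%E _ _ _) sum_cvg).
near=> m; rewrite measure_ge0 /=.
have m0 : (0 < m)%N by near: m; exact: nbhs_infty_gt.
have mr0 : 0 < m%:R :> R by rewrite ltr0n.
pose A a := [set w | (a - theta) * (m%:R * a) <=
  (a - theta) * ln (1 + upper_record X m w)].
have mA a : measurable (A a).
  rewrite -[X in measurable X]setTI -[X in _ `&` X]preimage_true.
  have mR : measurable_fun [set: T] (fun w => 1 + upper_record X m w).
    by apply: measurable_funD => //; exact: measurable_upper_record.
  apply: measurable_fun_ler => //; apply: measurable_funM => //.
  exact: (measurableT_comp (@measurable_ln R) mR).
apply: (@le_trans _ _ (P (A up `|` A lo))).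
  apply: le_measure; rewrite ?inE.
  - by apply: measurable_deviation; exact: measurable_theta_records.
  - exact: measurableU.
  move=> w /= ew.
  have {ew} : e' < `|theta_records m (upper_record X m w) - theta|.
    by apply: le_lt_trans ew; rewrite ge_min lexx.
  rewrite /theta_records lter_normr.
  move=> /orP[dev|dev]; [left|right]; rewrite /A /=.
  - rewrite ler_pM2l ?subr_gt0 ?ltrDl// mulrC -ler_pdivlMr//.
    by rewrite /up; lra.
  - rewrite ler_nM2l ?subr_lt0 ?ltrBlDr ?ltrDl// mulrC -ler_pdivrMr//.
    by rewrite /lo; lra.
apply: (@le_trans _ _ (P (A up) + P (A lo))%E); first exact: measureU2.
apply: leeD; exact: ln_upper_record_tail.
Unshelve. all: by end_near. Qed.

End consistency.

(** The convention [0^-1 = 0] makes these two identities hold at [m = 0] and at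
[r = 0] as well, hence on the whole sample space. *)
Lemma pdf_recordsE {R : realType} m (x r : R) : pdf_records m x r =
  (theta_records m r)^-1 * (1 + x) `^ (- ((theta_records m r)^-1 + 1)).
Proof. by rewrite /pdf_records /theta_records invf_div. Qed.

Lemma cdf_recordsE {R : realType} m (x r : R) : cdf_records m x r =
  1 - (1 + x) `^ (- (theta_records m r)^-1).
Proof. by rewrite /cdf_records /theta_records invf_div. Qed.

Lemma continuous_powRr {R : realType} (a : R) : 0 < a ->
  continuous (fun y : R => a `^ y).
Proof.
move=> a0 y; rewrite (_ : (fun y => a `^ y) = (fun y => expR (y * ln a))).
  apply: (@cvg_comp _ _ _ (fun y => y * ln a) expR).
    exact: mulrr_continuous.
  exact: continuous_expR.
by apply/funext => z; rewrite /powR gt_eqF.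
Qed.

Theorem theorem6 (R : realType) (d : measure_display) (T : measurableType d)
    (P : probability T R) (theta : R) (X : nat -> {RV P >-> R})
    (theta_gt0 : 0 < theta)
    (X_indep : mutually_independent X)
    (X_lomax : forall i : nat, has_lomax_law theta (X i)) :
  [/\ forall x : R, 0 <= x ->
        cvg_in_probability P
          (fun m w => pdf_records m x (upper_record X m w))
          (lomax_pdf theta x),
      forall x : R, 0 <= x ->
        cvg_in_probability P
          (fun m w => cdf_records m x (upper_record X m w))
          (lomax_cdf theta x)
    & cvg_in_probability P
        (fun m w => theta_records m (upper_record X m w))
        theta].
Proof.
have thetaP := theta_records_consistent theta_gt0 X_indep X_lomax.
have cinv : {for theta, continuous (@GRing.inv R)}.
  by apply: inv_continuous; rewrite gt_eqF.
split=> // x x0; have x1 : 0 < 1 + x by rewrite ltr_wpDr.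
- rewrite /lomax_pdf x0; under eq_fun do under eq_fun do rewrite pdf_recordsE.
  apply: (cvg_in_probability_continuous
    (g := fun t => t^-1 * (1 + x) `^ (- (t^-1 + 1)))) => //.
  + apply: measurable_funM; first exact: measurable_inv.
    apply: (measurableT_comp (measurable_powRr _)).
    apply: measurableT_comp => //; apply: measurable_funD => //.
    exact: measurable_inv.
  + apply: cvgM => //.
    apply: (@cvg_comp _ _ _ (fun t => - (t^-1 + 1)) (powR (1 + x))); last first.
      exact: continuous_powRr.
    by apply: cvgN; apply: cvgD => //; exact: cvg_cst.
- rewrite /lomax_cdf x0; under eq_fun do under eq_fun do rewrite cdf_recordsE.
  apply: (cvg_in_probability_continuous
    (g := fun t => 1 - (1 + x) `^ (- t^-1))) => //.
  + apply: measurable_funB => //.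
    apply: (measurableT_comp (measurable_powRr _)).
    by apply: measurableT_comp => //; exact: measurable_inv.
  + apply: cvgB; first exact: cvg_cst.
    apply: (@cvg_comp _ _ _ (fun t => - t^-1) (powR (1 + x))); last first.
      exact: continuous_powRr.
    exact: cvgN.
Qed.
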